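(* Let $G=(V,E)$ be a loop-free multigraph with $n=|V|$ and let $\eta_n=\sum_{i=1}^n \frac1i$. Every vertex order $\sigma$ produced by the greedy algorithm (with any tie-breaking) satisfies $\sum_{v\in V}\overleftarrow{d}_\sigma(v)^2\le 4\eta_n\cdot \min_{\tau}\sum_{v\in V}\overleftarrow{d}_\tau(v)^2$, the minimum being over all vertex orders $\tau$ of $G$.
   Context: A vertex order is a linear ordering $\sigma=(\sigma_1,\dots,\sigma_n)$ of $V$; the left-degree $\overleftarrow{d}_\sigma(v)$ of $v=\sigma_i$ is the number of edges (with multiplicity) joining $v$ to $\{\sigma_1,\dots,\sigma_{i-1}\}$. The greedy algorithm builds the order from right to left: repeatedly, it picks a vertex of minimum degree in the current (remaining) graph, places it at the last still-free position, and deletes it from the graph. *)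

(* Defs.v *)
From mathcomp Require Import all_boot all_order all_algebra.

Set Implicit Arguments.
Unset Strict Implicit.
Unset Printing Implicit Defensive.

Import Order.TTheory GRing.Theory Num.Theory.

(* Parallel edges are distinct elements of [edge] with the same ends; every
   edge has exactly two ends, so there are no loops. *)
Record multigraph (V : finType) := Multigraph {
  edge :> finType;
  ends : edge -> {set V};
  ends_card2 : forall e, #|ends e| = 2
}.

Section Orders.
Variables (V : finType) (G : multigraph V).
Implicit Types (u v : V) (S R : {set V}) (s : seq V).

Definition edges_to v S : {set G} :=
  [set e | [exists u in S, ends e == [set v; u]]].

(* As a uniq tuple of size #|V|, an order lists each vertex exactly once. *)
Definition is_vertex_order (s : #|V|.-tuple V) : bool := uniq s.

Definition left_degree s v : nat :=
  #|edges_to v [set u in take (index v s) s]|.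

(* The degree of v in the subgraph of G induced by R. *)
Definition degree_in R v : nat :=
  #|[set e : G | (ends e \subset R) && (v \in ends e)]|.

(* [greedy_run R s]: started on the subgraph induced by R, the algorithm may
   output s. Positions are filled from the right, so the vertex picked first
   is the last one of s. *)
Inductive greedy_run : {set V} -> seq V -> Prop :=
| greedy_stop : greedy_run set0 [::]
| greedy_pick R v s :
    v \in R -> (forall u, u \in R -> degree_in R v <= degree_in R u) ->
    greedy_run (R :\ v) s -> greedy_run R (rcons s v).

Definition greedy_order s : Prop := greedy_run [set: V] s.

Definition cost s : nat := \sum_(v : V) left_degree s v ^ 2.

(* [enum_tuple V] only serves as a first candidate, needed by [arg min]. *)
Definition min_cost : nat :=
  cost [arg min_(t < enum_tuple V | is_vertex_order t) cost t].

Lemma min_cost_attained : exists2 t, is_vertex_order t & cost t = min_cost.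
Proof.
rewrite /min_cost; case: arg_minnP => [|t ot _]; first exact: enum_uniq.
by exists t.
Qed.

Lemma min_cost_le (t : #|V|.-tuple V) : is_vertex_order t -> min_cost <= cost t.
Proof.
rewrite /min_cost; case: arg_minnP => [|t0 _ min_t0]; first exact: enum_uniq.
exact: min_t0.
Qed.

End Orders.

Definition harmonic_number (n : nat) : rat := (\sum_(1 <= i < n.+1) i%:R^-1)%R.

(* Main.v *)
(** Let [d] be the left-degree of the [i]-th vertex of a greedy order and [m]
    the number of edges inside the set [S] of its first [i] vertices.  Greedy
    picks a minimum, so [d] is at most the average degree [2 m / i].  For any
    order [tau], the left-degrees of the vertices of [S] already account for all
    edges inside [S], so by Cauchy-Schwarz [m ^ 2 <= i * cost tau].  Hence
    [d ^ 2 <= 4 * cost tau / i], and summing over [i] gives the harmonic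
    number. *)

Require Import Defs.
From mathcomp Require Import all_boot all_order all_algebra.
Import Order.TTheory GRing.Theory Num.Theory.
Local Open Scope ring_scope.

(** Cauchy-Schwarz against the constant 1. After doubling, both sides are double sums over [A],
    compared term by term through [2 * (F i * F j) <= F i ^ 2 + F j ^ 2]. *)
Lemma sqr_sum_leq (T : finType) (A : {set T}) (F : T -> nat) :
  ((\sum_(i in A) F i) ^ 2 <= #|A| * \sum_(i in A) F i ^ 2)%N.
Proof.
rewrite -(leq_pmul2l (ltn0Sn 1)) expnS expn1 big_distrlr big_distrr /=.
have -> : (2 * (#|A| * \sum_(i in A) F i ^ 2) =
    \sum_(i in A) \sum_(j in A) (F i ^ 2 + F j ^ 2))%N.
  under [RHS]eq_bigr => i _ do rewrite big_split /= sum_nat_const.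
  by rewrite big_split /= sum_nat_const -big_distrr /= mul2n addnn.
apply: leq_sum => i _; rewrite big_distrr /=.
by apply: leq_sum => j _; apply: nat_Cauchy.
Qed.

Lemma harmonic_numberS (n : nat) :
  harmonic_number n.+1 = harmonic_number n + n.+1%:R^-1.
Proof. by rewrite /harmonic_number big_nat_recr. Qed.

Section GreedyBound.
Variables (V : finType) (G : multigraph V).
Implicit Types (u v : V) (R S : {set V}) (s : seq V).

Definition edges_in S : {set G} := [set e | ends e \subset S].

(** Links left-degrees to induced degrees: an edge has exactly two ends, so one inside [R] at [v]
    has its other end in [R :\ v]. *)
Lemma edges_to_setD1 R v : v \in R ->
  edges_to G v (R :\ v) = [set e : G | (ends e \subset R) && (v \in ends e)].
Proof.
move=> vR; apply/setP=> e; rewrite !inE.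
apply/existsP/andP=> [[u /andP[]]|[eR ve]].
  rewrite !inE => /andP[_ uR] /eqP->.
  by rewrite subUset !sub1set vR uR !inE eqxx.
have /cards1P[u eu] : #|ends e :\ v| == 1%N.
  by move/eqP: (cardsD1 v (ends e)); rewrite ve ends_card2 eqSS eq_sym.
have := set11 u; rewrite -eu !inE => /andP[uv ue].
exists u; rewrite !inE uv (subsetP eR) //=.
by rewrite -eu setD1K.
Qed.

(** Handshake lemma, by counting incident vertex-edge pairs in two ways. *)
Lemma sum_degree_in R :
  (\sum_(v in R) degree_in G R v = 2 * #|edges_in R|)%N.
Proof.
under eq_bigr => v _ do rewrite /degree_in -sum1dep_card big_mkcondr /=.
rewrite exchange_big /= mulnC -sum_nat_const.
apply: eq_big => [e|e eR]; first by rewrite inE.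
rewrite -big_mkcondr sum1dep_card -(ends_card2 e); apply: eq_card => v.
by rewrite !inE andb_idl // => /(subsetP eR).
Qed.

(** Each edge inside [S] is counted in the left-degree of whichever of its ends comes later in
    [s]. *)
Lemma edges_in_leq_sum (s : #|V|.-tuple V) S : is_vertex_order s ->
  (#|edges_in S| <= \sum_(v in S) left_degree G s v)%N.
Proof.
move=> us.
have ms v : v \in val s.
  have sV : {subset s <= enum V} by move=> x; rewrite mem_enum.
  have szV : (size (enum V) <= size s)%N by rewrite size_tuple cardE.
  by have [_ ->] := uniq_min_size us sV szV; rewrite mem_enum.
have earlier u v : (index u s < index v s)%N -> u \in take (index v s) s.
  by move=> ltuv; rewrite in_take // ltnW.
under eq_bigr => v _ do rewrite /left_degree -sum1_card.
rewrite -sum1_card (exchange_big_dep predT) //=.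
rewrite big_mkcond; apply: leq_sum => e _; rewrite inE; case: ifP => // eS.
suff [v vS ev] :
    exists2 v, v \in S & e \in edges_to G v [set u in take (index v s) s].
  by rewrite (bigD1 v) ?vS.
have /cards2P[x [y [xy exy]]] : #|ends e| == 2%N by rewrite ends_card2.
move: eS; rewrite exy subUset !sub1set => /andP[xS yS].
have [lt|lt|eqi] := ltngtP (index x s) (index y s).
- exists y => //; rewrite inE; apply/existsP; exists x.
  by rewrite inE earlier //= exy setUC.
- exists x => //; rewrite inE; apply/existsP; exists y.
  by rewrite inE earlier //= exy.
- by case/negP: xy; apply/eqP/(index_inj x (ms x) (ms y)).
Qed.

Lemma sqr_edges_in_leq_min_cost S :
  (#|edges_in S| ^ 2 <= #|S| * min_cost G)%N.
Proof.
have [t ot <-] := min_cost_attained G.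
apply: leq_trans (_ : (\sum_(v in S) left_degree G t v) ^ 2 <= _)%N.
  by rewrite leq_exp2r // edges_in_leq_sum.
apply: leq_trans (sqr_sum_leq _ _ _) _; rewrite leq_mul2l; apply/orP; right.
by rewrite /cost [leqRHS](bigID (mem S)) leq_addr.
Qed.

Lemma sqr_min_degree_leq R v : v \in R ->
  (forall u, u \in R -> (degree_in G R v <= degree_in G R u)%N) ->
  (#|R| * degree_in G R v ^ 2 <= 4 * min_cost G)%N.
Proof.
move=> vR minv.
have R_gt0 : (0 < #|R|)%N by apply/card_gt0P; exists v.
have le2m : (#|R| * degree_in G R v <= 2 * #|edges_in R|)%N.
  by rewrite -sum_degree_in -sum_nat_const; apply: leq_sum.
(* The extra factor [#|R|] completes the square [(#|R| * degree_in G R v) ^ 2], to which [le2m]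
   applies. *)
rewrite -(leq_pmul2l R_gt0) mulnA mulnn -expnMn.
apply: leq_trans (_ : (2 * #|edges_in R|) ^ 2 <= _)%N; first by rewrite leq_exp2r.
by rewrite expnMn mulnCA leq_mul2l sqr_edges_in_leq_min_cost.
Qed.

Lemma greedy_run_uniq_mem R s : greedy_run G R s -> uniq s /\ s =i R.
Proof.
elim=> [|{}R v {}s vR _ _ [us sR]]; first by split=> // x; rewrite !inE.
split=> [|x]; first by rewrite rcons_uniq us sR !inE eqxx.
by rewrite mem_rcons inE sR !inE; case: eqVneq => [->|].
Qed.

Lemma left_degree_rcons s v u : u \in s ->
  left_degree G (rcons s v) u = left_degree G s u.
Proof.
by move=> us; rewrite /left_degree -cats1 index_cat us take_cat index_mem us.
Qed.

Lemma left_degree_rcons_last s v : v \notin s ->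
  left_degree G (rcons s v) v = #|edges_to G v [set u in s]|.
Proof.
move=> vs; rewrite /left_degree -cats1 index_cat (negPf vs) /= eqxx addn0.
by rewrite take_size_cat.
Qed.

(** Induction on the run: the vertex picked from [R] contributes the term [#|R|^-1] of the harmonic
    number, and appending it leaves the other left-degrees unchanged. [min_cost G] refers to the
    whole graph throughout, so it stays fixed as [R] shrinks. *)
Lemma greedy_run_sum_leq R s : greedy_run G R s ->
  (\sum_(v in R) left_degree G s v ^ 2)%:R
    <= 4%:R * harmonic_number #|R| * (min_cost G)%:R :> rat.
Proof.
elim=> [|{}R v {}s vR minv run IH].
  by rewrite big_set0 cards0 /harmonic_number big_geq // mulr0 mul0r.
have [us sR] := greedy_run_uniq_mem _ _ run.
have set_s : [set u in s] = R :\ v by apply/setP=> u; rewrite inE sR.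
have cardR : #|R| = #|R :\ v|.+1 by rewrite (cardsD1 v) vR.
rewrite (big_setD1 v) //= left_degree_rcons_last ?sR ?inE ?eqxx //.
rewrite set_s edges_to_setD1 // -/(degree_in G R v).
under eq_bigr => u uR do rewrite left_degree_rcons ?sR //.
rewrite cardR harmonic_numberS natrD addrC mulrDr mulrDl lerD //.
rewrite -cardR mulrAC ler_pdivlMr ?cardR ?ltr0Sn // -cardR -!natrM ler_nat.
by rewrite mulnC sqr_min_degree_leq.
Qed.

End GreedyBound.

Theorem theorem8 (V : finType) (G : multigraph V) (sigma : #|V|.-tuple V)
    (sigma_order : is_vertex_order sigma)
    (sigma_greedy : greedy_order G sigma) :
  (cost G sigma)%:R <= 4%:R * harmonic_number #|V| * (min_cost G)%:R :> rat.
Proof.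
have := greedy_run_sum_leq _ _ _ _ sigma_greedy.
rewrite cardsT /cost; congr (_%:R <= _).
by apply: eq_bigl => v; rewrite inE.
Qed.
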